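(* For every $f\in\mathrm{Bir}_{2,2}(\mathbb P^{n-1})$ there exists a Jordan algebra $\mathbb J_f$ of rank $3$ (and dimension $n$) whose adjoint map $\#_{\mathbb J_f}:[x]\mapsto[x^\#]$ is linearly equivalent to $f$. In particular, every quadro-quadric Cremona transformation is linearly equivalent to an involution which is the adjoint map of a rank $3$ Jordan algebra.
   Context: $\mathrm{Bir}_{2,2}(\mathbb P^{n-1})$ denotes the set of birational maps of $\mathbb P^{n-1}$ such that both the map and its inverse are given by quadratic forms without common factor; these are the quadro-quadric Cremona transformations. Two such maps $f,f'$ are linearly equivalent if $f'=\ell_1\circ f\circ \ell_2$ for projective automorphisms $\ell_1,\ell_2$. A Jordan algebra is a finite-dimensional commutative complex algebra with unit $e$ satisfying $x^2(xy)=x(x^2y)$. Its rank is the dimension of the subalgebra generated by $e$ and a general element. In rank $3$ there are: \begin{itemize} \item a linear form $T$; \item a quadratic form $S$; \item a cubic form $N$ (the generic norm), \end{itemize} with $x^3-T(x)x^2+S(x)x-N(x)e=0$. The adjoint is $x^\#=x^2-T(x)x+S(x)e$; it satisfies $(x^\#)^\#=N(x)x$. *)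

(* Defs.v *)
From mathcomp Require Import all_boot all_algebra.
From mathcomp Require Import reals.
From mathcomp Require Import complex.
From mathcomp Require Import mpoly.
Set Implicit Arguments. Unset Strict Implicit. Unset Printing Implicit Defensive.
Import GRing.Theory.
Local Open Scope ring_scope.

Section Defs.
Variables (K : fieldType) (n : nat).

Definition polymap := 'I_n -> {mpoly K[n]}.

Definition no_common_factor (F : polymap) : Prop :=
  forall q : {mpoly K[n]},
    (forall i, exists r : {mpoly K[n]}, F i = q * r) -> (msize q <= 1)%N.

Definition quadratic_map (F : polymap) : Prop :=
  forall i, F i \is 2.-homog.

(* F and G define the same rational map of P^{n-1}:
   both are not identically zero and F is proportional to G. *)
Definition same_ratmap (F G : polymap) : Prop :=
  (exists i, F i != 0) /\ (exists i, G i != 0) /\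
  forall i j, F i * G j = F j * G i.

Definition pmcomp (F G : polymap) : polymap :=
  fun i => F i \mPo [tuple G j | j < n].

Definition pmid : polymap := fun i => 'X_i.

Definition plin (A : 'M[K]_n) : polymap :=
  fun i => \sum_(j < n) A i j *: 'X_j.

Definition Bir22 (F : polymap) : Prop :=
  quadratic_map F /\ no_common_factor F /\
  exists G : polymap, quadratic_map G /\ no_common_factor G /\
    same_ratmap (pmcomp G F) pmid /\ same_ratmap (pmcomp F G) pmid.

Definition lin_equiv (F F' : polymap) : Prop :=
  exists A B : 'M[K]_n, A \in unitmx /\ B \in unitmx /\
    same_ratmap F' (pmcomp (plin A) (pmcomp F (plin B))).

(* An n-dimensional commutative algebra structure on 'rV[K]_n is given by
   structure constants c : c i j k = k-th coordinate of (e_i * e_j). *)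
Definition sconst := 'I_n -> 'I_n -> 'I_n -> K.

Definition amul (c : sconst) (x y : 'rV[K]_n) : 'rV[K]_n :=
  \row_k \sum_(i < n) \sum_(j < n) c i j k * x 0 i * y 0 j.

Definition is_jordan (c : sconst) (e : 'rV[K]_n) : Prop :=
  (forall x y, amul c x y = amul c y x) /\
  (forall x, amul c e x = x) /\
  (forall x y, amul c (amul c x x) (amul c x y) =
               amul c x (amul c (amul c x x) y)).

Definition is_subalg (c : sconst) (U : 'M[K]_n) : Prop :=
  forall u v : 'rV[K]_n, (u <= U)%MS -> (v <= U)%MS -> (amul c u v <= U)%MS.

Definition gen_subalg_dim (c : sconst) (e x : 'rV[K]_n) (d : nat) : Prop :=
  (exists U : 'M[K]_n, is_subalg c U /\ (e <= U)%MS /\ (x <= U)%MS /\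
       \rank U = d) /\
  (forall U : 'M[K]_n, is_subalg c U -> (e <= U)%MS -> (x <= U)%MS ->
       (d <= \rank U)%N).

(* Rank: the dimension of the subalgebra generated by e and a general element
   (= the maximal such dimension over all elements). *)
Definition alg_rank (c : sconst) (e : 'rV[K]_n) (r : nat) : Prop :=
  (exists x, gen_subalg_dim c e x r) /\
  (forall x d, gen_subalg_dim c e x d -> (d <= r)%N).

Definition peval (p : {mpoly K[n]}) (x : 'rV[K]_n) : K := p.@[fun i => x 0 i].

Definition rank3_forms (c : sconst) (e : 'rV[K]_n)
    (T S N : {mpoly K[n]}) : Prop :=
  T \is 1.-homog /\ S \is 2.-homog /\ N \is 3.-homog /\
  forall x : 'rV[K]_n,
    amul c x (amul c x x) - peval T x *: amul c x x + peval S x *: x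
      - peval N x *: e = 0.

Definition adjoint_map (c : sconst) (e : 'rV[K]_n) (T S : {mpoly K[n]})
    : polymap :=
  fun k => \sum_(i < n) \sum_(j < n) c i j k *: ('X_i * 'X_j)
           - T * 'X_k + S * (e 0 k)%:MP.

End Defs.

(* Main.v *)
(* Write F for the map, G for its inverse, so that G(F(x)) = N(x) x with N a cubic form. After
   composing F with a linear map, there is a point e with N(e) = 1 and dF_e(x) = T(x) e - x, where
   T = dN_e. Expanding G(F(x)) = N(x) x to second order at e gives G = F + s e for a quadratic
   form s. If e, x, F(x) were always dependent, F(x) = a(x) x + b(x) e with a linear, and a would
   divide F; so they are generically independent, and comparing F(G(x)) with G(F(x)) modulo e, x
   gives s = 0, i.e. F = G is an involution x -> x^#. Let x*y be the polarization of #. The two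
   products of the operators x* and x^#* are N(x) Id plus a rank one operator, while their
   commutator follows from polarizing x^## = N(x) x in the direction e; comparing coefficients of
   x^# yields dN_x(y) = T(x^#) T(y) - T(x^# * y). With this trace identity, the product
   2 xy = x*y + T(x) y + T(y) x - T(x*y) e satisfies the Jordan identity by direct computation. *)
Require Import Defs.
From mathcomp Require Import all_boot all_algebra.
From mathcomp Require Import reals.
From mathcomp Require Import complex.
From mathcomp Require Import mpoly.
From mathcomp Require Import ring boolp.
Import GRing.Theory.
Local Open Scope ring_scope.
Set Implicit Arguments. Unset Strict Implicit. Unset Printing Implicit Defensive.

(** * Polynomials as functions over an infinite field *)

Lemma poly_horner_eq0 (K : numFieldType) (p : {poly K}) :
  (forall t, p.[t] = 0) -> p = 0.
Proof.
move=> p0; apply/eqP; apply: contraT => /max_poly_roots roots_p.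
have /roots_p : all (root p) [seq i%:R | i <- iota 0 (size p)].
  by apply/allP=> t _; apply/eqP/p0.
rewrite size_map size_iota ltnn; apply.
by rewrite map_inj_uniq ?iota_uniq // => i j /eqP; rewrite Num.Theory.eqr_nat => /eqP.
Qed.

(** Induction on the number of variables: [muni] reads [p] as a polynomial in the last variable.
    Specializing its coefficients at any [w] gives a univariate polynomial with only zero values, so
    every coefficient vanishes at every [w]. *)
Lemma mpoly_meval_eq0 (K : numFieldType) (n : nat) (p : {mpoly K[n]}) :
  (forall v : 'I_n -> K, p.@[v] = 0) -> p = 0.
Proof.
elim: n p => [|n IHn] p p0; apply/mpolyP=> m; rewrite mcoeff0.
  have m0 k : k = 0%MM :> 'X_{1..0} by apply/mnmP=> -[].
  have p_const : p = (p@_0)%:MP.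
    by apply/mpolyP=> k; rewrite (m0 k) mcoeffC eqxx mulr1.
  by rewrite (m0 m) -(p0 (fun=> 0)) [in RHS]p_const mevalC.
(* [r k] forgets the last exponent; a monomial is recovered from [r k] and [k ord_max]. *)
pose r (k : 'X_{1..n.+1}) := [multinom k (widen_ord (leqnSn n) i) | i < n].
have r_inj k : (r k == r m) && (k ord_max == m ord_max) -> k = m.
  case/andP=> /eqP/mnmP km /eqP max_km; apply/mnmP=> i.
  case: (unliftP ord_max i) => [j ->|-> //].
  have -> : lift ord_max j = widen_ord (leqnSn n) j.
    by apply/val_inj; rewrite /= /bump leqNgt ltn_ord.
  by move: (km j); rewrite !mnmE.
suff muni0 k : (muni p)`_k = 0.
  have := congr1 (mcoeff (r m)) (muni0 (m ord_max)).
  rewrite mcoeff0 => <-; rewrite muniE coef_sum raddf_sum /= [in LHS](mpolyE p).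
  rewrite raddf_sum /=; apply: eq_bigr => k _.
  rewrite mcoeffZ mcoeffX coefZ coefXn.
  case: eqP => [->|neq_km]; first by rewrite !eqxx mulr1 mulr1 mcoeffZ mcoeffX eqxx mulr1.
  have /nandP[r_neq|/negPf max_neq] : ~~ ((r k == r m) && (k ord_max == m ord_max)).
  - by apply/negP => /r_inj.
  - case: (_ == _); rewrite ?mulr1 ?mulr0 ?mcoeff0 ?mulr0 //.
    by rewrite mcoeffZ mcoeffX (negPf r_neq) !mulr0.
  by rewrite eq_sym max_neq !mulr0 mcoeff0.
apply: IHn => w.
pose q := map_poly (meval w) (muni p).
suff q0 : q = 0 by have := congr1 (fun q : {poly K} => q`_k) q0; rewrite coef_map coef0.
apply: poly_horner_eq0 => t.
pose v (i : 'I_n.+1) := if unlift ord_max i is Some j then w j else t.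
rewrite -(p0 v) /q muniE raddf_sum horner_sum mevalE.
apply: eq_bigr => m' _ /=.
rewrite map_polyZ /= map_polyXn !hornerE mevalZ mevalX big_ord_recr /=.
rewrite /v unlift_none -mulrA; congr (_ * (_ * _)).
apply: eq_bigr => i _; rewrite mnmE.
have -> : widen_ord (leqnSn n) i = lift ord_max i.
  by apply/val_inj; rewrite /= /bump leqNgt ltn_ord.
by rewrite liftK.
Qed.

Section PolynomialFunctions.
Variables (K : numFieldType) (n : nat).
Implicit Types (x y z : 'rV[K]_n) (f g : 'rV[K]_n -> K) (p q : {mpoly K[n]}).

Lemma peval_inj p q : (forall x, peval p x = peval q x) -> p = q.
Proof.
move=> pq; apply/eqP; rewrite -subr_eq0; apply/eqP/mpoly_meval_eq0 => v.
have := pq (\row_i v i); rewrite /peval !(meval_eq _ (fun i => mxE _ _ _ _)).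
by rewrite mevalB => ->; rewrite subrr.
Qed.

Definition polyfun f := exists p, forall x, f x = peval p x.

Lemma polyfun_ext f g : f =1 g -> polyfun f -> polyfun g.
Proof. by move=> fg [p fp]; exists p => x; rewrite -fg. Qed.

Lemma polyfun_const (a : K) : polyfun (fun=> a).
Proof. by exists a%:MP => x; rewrite /peval mevalC. Qed.

Lemma polyfun_coord i : polyfun (fun x => x 0 i).
Proof. by exists 'X_i => x; rewrite /peval mevalXU. Qed.

Lemma polyfunD f g : polyfun f -> polyfun g -> polyfun (fun x => f x + g x).
Proof. by move=> [p fp] [q gq]; exists (p + q) => x; rewrite /peval mevalD fp gq. Qed.

Lemma polyfunM f g : polyfun f -> polyfun g -> polyfun (fun x => f x * g x).
Proof. by move=> [p fp] [q gq]; exists (p * q) => x; rewrite /peval mevalM fp gq. Qed.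

Lemma polyfunB f g : polyfun f -> polyfun g -> polyfun (fun x => f x - g x).
Proof. by move=> [p fp] [q gq]; exists (p - q) => x; rewrite /peval mevalB fp gq. Qed.

Lemma polyfun_sum (I : finType) (h : I -> 'rV[K]_n -> K) :
  (forall i, polyfun (h i)) -> polyfun (fun x => \sum_i h i x).
Proof.
move=> ph; suff : forall s : seq I, polyfun (fun x => \sum_(i <- s) h i x) by apply.
elim=> [|i s IHs].
  by apply: polyfun_ext (polyfun_const 0) => x; rewrite big_nil.
by apply: polyfun_ext (polyfunD (ph i) IHs) => x; rewrite big_cons.
Qed.

(** Zariski density: [f * g] vanishes identically, and the polynomial ring is a domain. Identities
    proved at generic points are extended to all points this way. *)
Lemma polyfun_dense f g x0 : polyfun f -> f x0 != 0 -> polyfun g ->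
  (forall x, f x != 0 -> g x = 0) -> forall x, g x = 0.
Proof.
move=> [p fp] fx0 [q gq] g0 x.
have /eqP : p * q = 0.
  apply: peval_inj => y; rewrite /peval mevalM meval0 -!/(peval _ y) -fp -gq.
  by have [->|/g0 ->] := eqVneq (f y) 0; rewrite ?mul0r ?mulr0.
rewrite mulf_eq0 => /orP[/eqP p0|/eqP q0].
  by rewrite fp p0 /peval meval0 eqxx in fx0.
by rewrite gq q0 /peval meval0.
Qed.

Definition symbilinear (b : 'rV[K]_n -> 'rV[K]_n -> 'rV[K]_n) :=
  (forall x y, b x y = b y x) /\ (forall y, linear (b^~ y)).

Definition symtrilinear (t : 'rV[K]_n -> 'rV[K]_n -> 'rV[K]_n -> K) :=
  [/\ forall x y z, t x y z = t y x z, forall x y z, t x y z = t x z y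
    & forall y z, scalar (fun x => t x y z)].

Lemma scalar_delta f : scalar f -> forall x, f x = \sum_i x 0 i * f (delta_mx 0 i).
Proof.
move=> flin x; have f0 : f 0 = 0.
  by have := flin (-1) 0 0; rewrite scaler0 addr0 mulN1r addNr.
rewrite [in LHS](row_sum_delta x).
elim: (index_enum _) => [|i s IHs]; rewrite ?big_nil // !big_cons flin IHs //.
Qed.

Lemma linear_delta (f : 'rV[K]_n -> 'rV[K]_n) : linear f ->
  forall x, f x = \sum_i x 0 i *: f (delta_mx 0 i).
Proof.
move=> flin x; apply/rowP=> k; rewrite summxE.
rewrite (@scalar_delta (fun y => f y 0 k)); last by move=> a y z; rewrite flin !mxE.
by apply: eq_bigr => i _; rewrite !mxE.
Qed.

Lemma polyfun_scalar f (u : 'rV[K]_n -> 'rV[K]_n) : scalar f ->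
  (forall i, polyfun (fun x => u x 0 i)) -> polyfun (fun x => f (u x)).
Proof.
move=> flin pu; apply: polyfun_ext (fun x => esym (scalar_delta flin (u x))) _.
by apply: polyfun_sum => i; apply: polyfunM; [apply: pu|apply: polyfun_const].
Qed.

Lemma polyfun_bilinear (b : 'rV[K]_n -> 'rV[K]_n -> K)
    (u v : 'rV[K]_n -> 'rV[K]_n) :
  (forall y, scalar (b^~ y)) -> (forall x, scalar (b x)) ->
  (forall i, polyfun (fun x => u x 0 i)) -> (forall i, polyfun (fun x => v x 0 i)) ->
  polyfun (fun x => b (u x) (v x)).
Proof.
move=> bl br pu pv; apply: (@polyfun_ext (fun x => \sum_i u x 0 i * b (delta_mx 0 i) (v x))).
  by move=> x; rewrite (scalar_delta (bl _)).
apply: polyfun_sum => i; apply: polyfunM; first exact: pu.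
exact: polyfun_scalar.
Qed.

Lemma dhomog_ind (Q : {mpoly K[n]} -> Prop) d :
  Q 0 -> (forall a p q, Q p -> Q q -> Q (a *: p + q)) ->
  (forall m, mdeg m = d -> Q 'X_[m]) ->
  forall p, p \is d.-homog -> Q p.
Proof.
move=> Q0 Qlin QX p /dhomogP hp; rewrite (mpolyE p) big_seq.
elim/big_rec: _ => [//|m q p_m Qq]; apply: Qlin => //; apply: QX; exact: hp.
Qed.

End PolynomialFunctions.

(** * Homogeneous forms, their polarizations and divisibility by variables *)

Section Homogeneous.
Variables (K : numFieldType) (n : nat).
Implicit Types (x y z : 'rV[K]_n) (p q : {mpoly K[n]}).

Lemma mdegSP (m : 'X_{1..n}) d : mdeg m = d.+1 ->
  exists i m', m = (U_(i) + m')%MM /\ mdeg m' = d.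
Proof.
move=> degm; have /existsP[i mi] : [exists i, m i != 0%N].
  apply: contraPT degm; rewrite negb_exists => /forallP m0.
  by rewrite mdegE big1 // => i _; apply/eqP; rewrite -[_ == _]negbK m0.
have Um : (U_(i) <= m)%MM by rewrite lep1mP.
exists i, (m - U_(i))%MM; split; first by rewrite addmC submK.
by apply/eqP; rewrite -eqSS -degm -{2}(submK Um) mdegD mdeg1 addn1.
Qed.

Definition polar2 p x y := peval p (x + y) - peval p x - peval p y.

(** Third finite difference at the origin, without the term [peval p 0], which vanishes for a form
    of positive degree. *)
Definition polar3 p x y z := peval p (x + y + z) - peval p (x + y)
  - peval p (x + z) - peval p (y + z) + peval p x + peval p y + peval p z.

Lemma pevalZD a p q x : peval (a *: p + q) x = a * peval p x + peval q x.
Proof. by rewrite /peval mevalD mevalZ. Qed.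

Lemma pevalM p q x : peval (p * q) x = peval p x * peval q x.
Proof. exact: mevalM. Qed.

Lemma pevalX i x : peval 'X_i x = x 0 i.
Proof. exact: mevalXU. Qed.

Lemma peval0 x : peval (0 : {mpoly K[n]}) x = 0.
Proof. exact: meval0. Qed.

Lemma polar2_homog p : p \is 2.-homog ->
  (forall y, scalar (polar2 p ^~ y)) /\ (forall x, polar2 p x x = 2 * peval p x).
Proof.
elim/dhomog_ind => [|a {}p q [pl pd] [ql qd]|m /mdegSP[i [_ [-> /eqP/mdeg1P[j /eqP->]]]]].
- by split=> [y b u v|x]; rewrite /polar2 !peval0; ring.
- have E x y : polar2 (a *: p + q) x y = a * polar2 p x y + polar2 q x y.
    by rewrite /polar2 !pevalZD; ring.
  by split=> [y b u v|x]; rewrite !E ?pl ?ql ?pd ?qd ?pevalZD; ring.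
- rewrite mpolyXD.
  by split=> [y b u v|x]; rewrite /polar2 !pevalM !pevalX !mxE; ring.
Qed.

Lemma polar3_homog p : p \is 3.-homog ->
  symtrilinear (polar3 p) /\ (forall x, polar3 p x x x = 6 * peval p x).
Proof.
move=> hp; suff [pl pd] : (forall y z, scalar (fun x => polar3 p x y z)) /\
    (forall x, polar3 p x x x = 6 * peval p x).
  split=> //; split=> // x y z; rewrite /polar3; first by rewrite [y + x]addrC; ring.
  by rewrite [z + y]addrC [x + z + y]addrAC; ring.
elim/dhomog_ind: hp => [|a {}p q [pl pd] [ql qd]|].
- by split=> [y z b u v|x]; rewrite /polar3 !peval0; ring.
- have E x y z : polar3 (a *: p + q) x y z = a * polar3 p x y z + polar3 q x y z.
    by rewrite /polar3 !pevalZD; ring.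
  by split=> [y z b u v|x]; rewrite !E ?pl ?ql ?pd ?qd ?pevalZD; ring.
- move=> m /mdegSP[i [_ [-> /mdegSP[j [_ [-> /eqP/mdeg1P[k /eqP->]]]]]]].
  rewrite !mpolyXD.
  by split=> [y z b u v|x]; rewrite /polar3 !pevalM !pevalX !mxE; ring.
Qed.

Lemma mcoeffMXU0 p i (m : 'X_{1..n}) : m i = 0%N -> (p * 'X_i)@_m = 0.
Proof.
move=> mi; apply/eqP; rewrite mcoeff_eq0 (perm_mem (msuppMX _ _)).
by apply/mapP => -[k _ mE]; rewrite mE mnmDE mnm1E eqxx in mi.
Qed.

(** A second variable ['X_j0] is what forces divisibility: a monomial of [h i0] without ['X_i0]
    would survive in [h i0 * 'X_j0 = h j0 * 'X_i0]. The quotient of [h i0] by ['X_i0] then serves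
    every index, by cancelling ['X_i0]. *)
Lemma mpolyX_dvd_family (h : 'I_n -> {mpoly K[n]}) : (1 < n)%N ->
  (forall i j, h i * 'X_j = h j * 'X_i) -> exists q, forall i, h i = q * 'X_i.
Proof.
move=> n_gt1 hX; pose i0 := Ordinal (ltnW n_gt1); pose j0 := Ordinal n_gt1.
have supp m : m \in msupp (h i0) -> (U_(i0) <= m)%MM.
  rewrite lep1mP mcoeff_msupp; apply: contraNN => /eqP mi0.
  rewrite -(mcoeffMX _ U_(j0)) hX mcoeffMXU0 // mnmDE mi0 addn0 mnm1E.
  by case: eqP.
pose q := \sum_(m <- msupp (h i0)) (h i0)@_m *: 'X_[m - U_(i0)].
have hi0 : h i0 = q * 'X_i0.
  rewrite [LHS]mpolyE mulr_suml !big_seq; apply: eq_bigr => m /supp im.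
  by rewrite -scalerAl -mpolyXD submK.
exists q => i; have X0 : 'X_i0 != 0 :> {mpoly K[n]} by rewrite -msupp_eq0 msuppX.
by apply: (mulIf X0); rewrite hX hi0; ring.
Qed.

Lemma dhomog_divX p i d : p * 'X_i \is d.+1.-homog -> p \is d.-homog.
Proof.
move=> /dhomogP hp; apply/dhomogP => m; rewrite mcoeff_msupp -(mcoeffMX _ U_(i)) -mcoeff_msupp.
by move=> /hp; rewrite /= mdegD mdeg1 => -[].
Qed.

Lemma dhomog_pmcomp (F G : polymap K n) i :
  quadratic_map F -> quadratic_map G -> pmcomp F G i \is 4.-homog.
Proof.
move=> qF qG; rewrite /pmcomp; elim/dhomog_ind: (qF i) => [|a p q hp hq|m].
- by rewrite comp_mpoly0 dhomog0.
- by rewrite comp_mpolyD comp_mpolyZ; apply: dhomogD => //; apply: dhomogZ.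
move=> /mdegSP[j [_ [-> /eqP/mdeg1P[k /eqP->]]]].
rewrite mpolyXD rmorphM /= !comp_mpolyXU -!tnth_nth !tnth_mktuple.
exact: (@dhomogM _ _ _ 2 _ 2).
Qed.

End Homogeneous.

(** * Computation rules for symmetric bilinear and trilinear maps *)

Section MultilinearRules.
Variables (K : numFieldType) (n : nat).
Implicit Types (x y z : 'rV[K]_n) (a : K).

Section Bilinear.
Variable b : 'rV[K]_n -> 'rV[K]_n -> 'rV[K]_n.
Hypothesis bP : symbilinear b.

Lemma symbilC x y : b x y = b y x.
Proof. exact: bP.1. Qed.

Lemma symbilDl x y z : b (x + y) z = b x z + b y z.
Proof. by have := bP.2 z 1 x y; rewrite !scale1r. Qed.

Lemma symbil0l z : b 0 z = 0.
Proof. by have := bP.2 z (-1) 0 0; rewrite scaler0 addr0 scaleN1r addNr. Qed.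

Lemma symbilZl a x z : b (a *: x) z = a *: b x z.
Proof. by have := bP.2 z a x 0; rewrite !addr0 symbil0l addr0. Qed.

Lemma symbilNl x z : b (- x) z = - b x z.
Proof. by rewrite -scaleN1r symbilZl scaleN1r. Qed.

Lemma symbilDr x y z : b z (x + y) = b z x + b z y.
Proof. by rewrite !(symbilC z) symbilDl. Qed.

Lemma symbilZr a x z : b z (a *: x) = a *: b z x.
Proof. by rewrite !(symbilC z) symbilZl. Qed.

Lemma symbilNr x z : b z (- x) = - b z x.
Proof. by rewrite !(symbilC z) symbilNl. Qed.

Definition symbilE := (symbilDl, symbilZl, symbilNl, symbilDr, symbilZr, symbilNr).

End Bilinear.

Section Trilinear.
Variable t : 'rV[K]_n -> 'rV[K]_n -> 'rV[K]_n -> K.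
Hypothesis tP : symtrilinear t.

Lemma symtriC12 x y z : t x y z = t y x z.
Proof. by case: tP. Qed.

Lemma symtriC23 x y z : t x y z = t x z y.
Proof. by case: tP. Qed.

Lemma symtriC13 x y z : t x y z = t z y x.
Proof. by rewrite symtriC12 symtriC23 symtriC12. Qed.

Lemma symtriDl x y u v : t (x + y) u v = t x u v + t y u v.
Proof. by case: tP => _ _ /(_ u v 1 x y); rewrite scale1r mul1r. Qed.

Lemma symtri0l u v : t 0 u v = 0.
Proof. by case: tP => _ _ /(_ u v (-1) 0 0); rewrite scaler0 addr0 mulN1r addNr. Qed.

Lemma symtriZl a x u v : t (a *: x) u v = a * t x u v.
Proof. by case: tP => _ _ /(_ u v a x 0); rewrite addr0 symtri0l addr0. Qed.

Lemma symtriNl x u v : t (- x) u v = - t x u v.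
Proof. by rewrite -scaleN1r symtriZl mulN1r. Qed.

Lemma symtriDm x y u v : t u (x + y) v = t u x v + t u y v.
Proof. by rewrite !(symtriC12 u) symtriDl. Qed.

Lemma symtriZm a x u v : t u (a *: x) v = a * t u x v.
Proof. by rewrite !(symtriC12 u) symtriZl. Qed.

Lemma symtriNm x u v : t u (- x) v = - t u x v.
Proof. by rewrite !(symtriC12 u) symtriNl. Qed.

Lemma symtriDr x y u v : t u v (x + y) = t u v x + t u v y.
Proof. by rewrite !(symtriC13 u) symtriDl. Qed.

Lemma symtriZr a x u v : t u v (a *: x) = a * t u v x.
Proof. by rewrite !(symtriC13 u) symtriZl. Qed.

Lemma symtriNr x u v : t u v (- x) = - t u v x.
Proof. by rewrite !(symtriC13 u) symtriNl. Qed.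

Definition symtriE := (symtriDl, symtriZl, symtriNl, symtriDm, symtriZm, symtriNm,
  symtriDr, symtriZr, symtriNr).

End Trilinear.

(* Evaluate at t = 0, 1, -1, 2, -2. *)
Lemma quartic_coef_eq0 (v0 v1 v2 v3 v4 : K) :
  (forall t, v0 + t * v1 + t ^+ 2 * v2 + t ^+ 3 * v3 + t ^+ 4 * v4 = 0) ->
  v1 = 0 /\ v2 = 0.
Proof.
move=> q0; split.
  have -> : v1 = 3^-1 * 2 * (v0 + 1 * v1 + 1 ^+ 2 * v2 + 1 ^+ 3 * v3 + 1 ^+ 4 * v4)
    - 3^-1 * 2 * (v0 + -1 * v1 + (-1) ^+ 2 * v2 + (-1) ^+ 3 * v3 + (-1) ^+ 4 * v4)
    - 12^-1 * (v0 + 2 * v1 + 2 ^+ 2 * v2 + 2 ^+ 3 * v3 + 2 ^+ 4 * v4)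
    + 12^-1 * (v0 + -2 * v1 + (-2) ^+ 2 * v2 + (-2) ^+ 3 * v3 + (-2) ^+ 4 * v4).
    by field.
  by rewrite !q0 !mulr0 !subr0 addr0.
have -> : v2 = 3^-1 * 2 * (v0 + 1 * v1 + 1 ^+ 2 * v2 + 1 ^+ 3 * v3 + 1 ^+ 4 * v4)
    + 3^-1 * 2 * (v0 + -1 * v1 + (-1) ^+ 2 * v2 + (-1) ^+ 3 * v3 + (-1) ^+ 4 * v4)
    - 24^-1 * (v0 + 2 * v1 + 2 ^+ 2 * v2 + 2 ^+ 3 * v3 + 2 ^+ 4 * v4)
    - 24^-1 * (v0 + -2 * v1 + (-2) ^+ 2 * v2 + (-2) ^+ 3 * v3 + (-2) ^+ 4 * v4)
    - 4^-1 * 5 * (v0 + 0 * v1 + 0 ^+ 2 * v2 + 0 ^+ 3 * v3 + 0 ^+ 4 * v4).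
  by field.
by rewrite !q0 !mulr0 !subr0 addr0.
Qed.

End MultilinearRules.

(** * A quadratic map and its inverse, normalized at a base point *)

Section BirationalPair.
Variables (K : numFieldType) (n : nat).
Notation V := 'rV[K]_n.
(* [b], [c], [t] are the polarizations of [F], [G], [N], and [N (e + x)] has linear part [T x]
   and quadratic part [S x]. *)
Variables (b c : V -> V -> V) (t : V -> V -> V -> K) (e : V).
Hypotheses (bP : symbilinear b) (cP : symbilinear c) (tP : symtrilinear t).

Notation F x := (2^-1 *: b x x).
Notation G x := (2^-1 *: c x x).
Notation N x := (6^-1 * t x x x).
Notation T x := (2^-1 * t e e x).
Notation S x := (2^-1 * t e x x).

Hypothesis GF : forall x, G (F x) = N x *: x.

Let bE := symbilE bP.
Let cE := symbilE cP.
Let tE := symtriE tP.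

(** These are the coefficients of [s] and [s ^+ 2] in the identity [GF] taken at [x + s *: y]. *)
Lemma GF_polar x y :
  c (F x) (b x y) = N x *: y + (2^-1 * t x x y) *: x /\
  c (F x) (F y) + G (b x y) = (2^-1 * t x x y) *: y + (2^-1 * t x y y) *: x.
Proof.
pose v1 := c (F x) (b x y) - (N x *: y + (2^-1 * t x x y) *: x).
pose v2 := c (F x) (F y) + G (b x y) - ((2^-1 * t x x y) *: y + (2^-1 * t x y y) *: x).
pose v3 := c (F y) (b x y) - (N y *: x + (2^-1 * t x y y) *: y).
have FD s : F (x + s *: y) = F x + s *: b x y + s ^+ 2 *: F y.
  rewrite !bE (symbilC bP y x); apply/rowP=> k; rewrite !mxE; by field.
have ND s : N (x + s *: y) = N x + s * (2^-1 * t x x y) + s ^+ 2 * (2^-1 * t x y y) + s ^+ 3 * N y.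
  rewrite !tE (symtriC13 tP y x x) (symtriC12 tP y x y) (symtriC13 tP y y x) (symtriC23 tP x y x).
  by field.
have v12 k : v1 0 k = 0 /\ v2 0 k = 0.
  (* The coefficients of degree 0 and 4 cancel by [GF] at [x] and at [y], hence the two zeros. *)
  apply: (@quartic_coef_eq0 _ 0 _ _ (v3 0 k) 0) => s.
  have := congr1 (fun u : V => u 0 k) (GF (x + s *: y)).
  rewrite /= ND FD.
  have GD u v w : G (u + s *: v + s ^+ 2 *: w) =
      G u + s *: c u v + s ^+ 2 *: (c u w + G v) + s ^+ 3 *: c v w + s ^+ 4 *: G w.
    rewrite !cE (symbilC cP v u) (symbilC cP w u) (symbilC cP w v).
    by apply/rowP=> j; rewrite !mxE; field.
  rewrite GD !GF /v1 /v2 /v3 (symbilC cP (F y) (b x y)) !mxE.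
  by move/eqP; rewrite -subr_eq0 => /eqP eq0; rewrite -[RHS]eq0; field.
by split; apply/eqP; rewrite -subr_eq0; apply/eqP/rowP=> k; rewrite [RHS]mxE; case: (v12 k).
Qed.

Hypotheses (be : forall x, b e x = T x *: e - x) (teee : t e e e = 6).

Let Te : T e = 3. Proof. by rewrite teee; field. Qed.

Let Fe : F e = e.
Proof. by rewrite be Te; apply/rowP=> k; rewrite !mxE; field. Qed.

Let Ge : G e = e.
Proof. by have := GF e; rewrite Fe teee => ->; apply/rowP=> k; rewrite !mxE; field. Qed.

(** The first-order part of [GF] at [e] is a linear equation for [c e x], because [b e x] is known
    and [c e e = 2 *: e]. *)
Lemma inverse_polar_base x : c e x = T x *: e - x.
Proof.
have [+ _] := GF_polar e x; rewrite Fe be teee !cE.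
have -> : c e e = 2 *: e by rewrite -[in RHS]Ge; apply/rowP=> k; rewrite !mxE; field.
move=> /rowP H; apply/rowP=> k; have := H k; rewrite !mxE.
set u := c e x 0 k => Hk.
have -> : u = - (2^-1 * t e e x * (2 * e 0 k) - u) + 2^-1 * t e e x * (2 * e 0 k) by ring.
by rewrite Hk; field.
Qed.

(** This is the second-order part of [GF] at [e], with both polars at [e] replaced by their normal
    form. *)
Lemma inverse_sub_base x : G x = F x + (S x - T (F x)) *: e.
Proof.
have [_] := GF_polar e x; rewrite Fe be !cE !inverse_polar_base.
rewrite !(symbilC cP x e) !inverse_polar_base.
rewrite !tE teee => /rowP H; apply/rowP=> k; have := H k; rewrite !mxE => Hk.
apply/eqP; rewrite -subr_eq0; apply/eqP; move/eqP: Hk; rewrite -subr_eq0 => /eqP Hk.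
by rewrite -[RHS]Hk; field.
Qed.

(** Projection along [e] onto the kernel of [T]; the factor 1/3 comes from [T e = 3]. *)
Definition base_proj x : V := x - (3^-1 * T x) *: e.
Notation P := base_proj.

Let PE a x y : P (a *: x + y) = a *: P x + P y.
Proof. by rewrite /P !tE; apply/rowP=> k; rewrite !mxE; ring. Qed.

Let P0 : P 0 = 0.
Proof. by have := PE (-1) 0 0; rewrite scaler0 addr0 scaleN1r addNr. Qed.

Let Pe : P e = 0.
Proof. by rewrite /P Te; apply/rowP=> k; rewrite !mxE; field. Qed.

Let PP x : P (P x) = P x.
Proof. by rewrite {2}/P addrC -scaleNr PE Pe scaler0 add0r. Qed.

(** A 2 by 2 minor of [F x] and [x] modulo [e]. It is polynomial in [x], so its nonvanishing
    expresses generic independence of [e], [x], [F x] in a form suited to [polyfun_dense]. *)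
Definition base_minor i j x := P (F x) 0 i * P x 0 j - P (F x) 0 j * P x 0 i.

(** Applying [P] removes [e]; Cramer's rule for coordinates [i] and [j] then kills [v] and [w], and
    [e] is nonzero by [teee]. *)
Lemma base_minor_free i j x u v w : base_minor i j x != 0 ->
  u *: e + v *: x + w *: F x = 0 -> [/\ u = 0, v = 0 & w = 0].
Proof.
move=> Mn0 uvw0.
have : P (u *: e + (v *: x + (w *: F x + 0))) = 0 by rewrite addr0 addrA uvw0 P0.
rewrite !PE Pe P0 scaler0 add0r addr0 => H.
have Hk k : v * P x 0 k + w * P (F x) 0 k = 0.
  have := congr1 (fun r : V => r 0 k) H.
  by move: (P x) (P (F x)) => p q; rewrite !mxE.
have [Hi Hj] := (Hk i, Hk j).
have w0 : w = 0.
  apply: (mulIf Mn0); rewrite mul0r /base_minor.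
  transitivity (P x 0 j * (v * P x 0 i + w * P (F x) 0 i)
     - P x 0 i * (v * P x 0 j + w * P (F x) 0 j)); first by ring.
  by rewrite Hi Hj !mulr0 subrr.
have v0 : v = 0.
  apply: (mulIf Mn0); rewrite mul0r /base_minor.
  transitivity (P (F x) 0 i * (v * P x 0 j + w * P (F x) 0 j)
     - P (F x) 0 j * (v * P x 0 i + w * P (F x) 0 i)); first by ring.
  by rewrite Hi Hj !mulr0 subrr.
move: uvw0; rewrite v0 w0 !scale0r !addr0 => ue; split=> //.
apply/eqP; case: eqP => // /eqP un0; have : u *: e == 0 by rewrite ue.
rewrite scaler_eq0 (negPf un0) /= => /eqP e0.
by move: teee; rewrite e0 (symtri0l tP) => /eqP; rewrite eq_sym Num.Theory.pnatr_eq0.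
Qed.

(** The coefficient of [s] in the vanishing minor at [x + s *: y]. *)
Lemma base_minor_polar : (forall i j x, base_minor i j x = 0) ->
  forall i j x y, P (b x y) 0 i * P x 0 j + P (F x) 0 i * P y 0 j =
                  P (b x y) 0 j * P x 0 i + P (F x) 0 j * P y 0 i.
Proof.
move=> M0 i j x y.
have FD s : F (x + s *: y) = F x + s *: b x y + s ^+ 2 *: F y.
  by rewrite !bE (symbilC bP y x); apply/rowP=> k; rewrite !mxE; field.
have PD s : P (x + s *: y) = s *: P y + P x by rewrite addrC PE.
have PFD s : P (F (x + s *: y)) = s *: P (b x y) + (s ^+ 2 *: P (F y) + P (F x)).
  by rewrite FD -addrA addrC -addrA !PE.
have key s : base_minor i j (x + s *: y) = 0 by exact: M0.
have M0x : base_minor i j x = 0 by exact: M0.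
move: key M0x; rewrite /base_minor.
set p := P x; set q := P y; set r := P (b x y); set u := P (F x); set v := P (F y).
have E s : P (F (x + s *: y)) 0 i * P (x + s *: y) 0 j -
    P (F (x + s *: y)) 0 j * P (x + s *: y) 0 i =
    (u 0 i * p 0 j - u 0 j * p 0 i) +
    s * (r 0 i * p 0 j + u 0 i * q 0 j - (r 0 j * p 0 i + u 0 j * q 0 i)) +
    s ^+ 2 * (v 0 i * p 0 j + r 0 i * q 0 j - (v 0 j * p 0 i + r 0 j * q 0 i)) +
    s ^+ 3 * (v 0 i * q 0 j - v 0 j * q 0 i) + s ^+ 4 * 0.
  rewrite PD PFD -/p -/q -/r -/u -/v.
  by move: p q r u v => p q r u v; rewrite !mxE; ring.
move=> key M0x; have [] := quartic_coef_eq0 (fun s => etrans (esym (E s)) (key s)).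
by move/eqP; rewrite subr_eq0 => /eqP.
Qed.

Let PZ a x : P (a *: x) = a *: P x.
Proof. by rewrite -[a *: x]addr0 PE P0 addr0. Qed.

Let n_neq0 : n%:R != 0 :> K.
Proof.
rewrite Num.Theory.pnatr_eq0; apply/eqP => n0; move: teee.
have -> : e = 0 by apply/rowP=> k; have := ltn_ord k; rewrite {2}n0.
by rewrite (symtri0l tP) => /eqP; rewrite eq_sym Num.Theory.pnatr_eq0.
Qed.

Let tr x := \sum_j P (b x (delta_mx 0 j)) 0 j.

(** If [P (F x) = a x *: P x] with [a] linear and [a e = -1], polarizing and taking the trace in [y]
    of [P (b x y) = a x *: P y + a y *: P x] gives [tr x = n * a x + T x / 3]. Solving for [a]
    yields this formula. *)
Definition base_factor x := n%:R^-1 * (tr x - 3^-1 * T x).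

Let T_scalar : scalar (fun x => T x).
Proof. by move=> a x y; rewrite !tE; ring. Qed.

Let tr_proj : \sum_j P (delta_mx 0 j) 0 j = n%:R - 1.
Proof.
rewrite /P; under eq_bigr => j _ do rewrite !mxE !eqxx /= mulrAC -mulrA.
rewrite big_split /= sumr_const card_ord; congr (_ + _).
rewrite sumrN; congr (- _).
have := scalar_delta T_scalar e; rewrite Te => H.
transitivity (3^-1 * \sum_i e 0 i * T (delta_mx 0 i)); last by rewrite -H; field.
by rewrite mulr_sumr; apply: eq_bigr => j _; ring.
Qed.

Lemma base_factor_scalar : scalar base_factor.
Proof.
move=> a x y; rewrite /base_factor.
have -> : tr (a *: x + y) = a * tr x + tr y.
  rewrite /tr mulr_sumr -big_split; apply: eq_bigr => j _ /=.
  by rewrite !bE PE; move: (P _) (P _) => p q; rewrite !mxE.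
by rewrite !tE; ring.
Qed.

Lemma base_factor_base : base_factor e = -1.
Proof.
rewrite /base_factor Te.
have -> : tr e = - (n%:R - 1).
  rewrite -tr_proj -sumrN; apply: eq_bigr => j _.
  rewrite be PE Pe scaler0 add0r -scaleN1r PZ.
  by move: (P _) => p; rewrite !mxE mulN1r.
by field.
Qed.

(** Contracting [base_minor_polar] over the basis vectors [y] replaces a pointwise proportionality
    factor, a priori only rational in [x], by the linear form [base_factor]. *)
Lemma base_projF : (forall i j x, base_minor i j x = 0) ->
  forall x, P (F x) = base_factor x *: P x.
Proof.
move=> M0 x; apply/rowP=> i.
have sum_eq : \sum_j (P (b x (delta_mx 0 j)) 0 i * P x 0 j + P (F x) 0 i * P (delta_mx 0 j) 0 j) =
    \sum_j (P (b x (delta_mx 0 j)) 0 j * P x 0 i + P (F x) 0 j * P (delta_mx 0 j) 0 i).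
  by apply: eq_bigr => j _; apply: base_minor_polar.
rewrite !big_split /= -!mulr_suml -mulr_sumr tr_proj in sum_eq.
have bx_lin : scalar (fun y => P (b x y) 0 i).
  by move=> a y z; rewrite !bE PE; move: (P _) (P _) => p q; rewrite !mxE.
have P_lin : scalar (fun y => P y 0 i).
  by move=> a y z; rewrite PE; move: (P _) (P _) => p q; rewrite !mxE.
have bxP : \sum_j P (b x (delta_mx 0 j)) 0 i * P x 0 j = P (b x (P x)) 0 i.
  by rewrite (scalar_delta bx_lin (P x)); apply: eq_bigr => j _; rewrite mulrC.
have FxP : \sum_j P (F x) 0 j * P (delta_mx 0 j) 0 i = P (F x) 0 i.
  by rewrite -(scalar_delta P_lin (P (F x))) PP.
have bxPx : b x (P x) = 2 *: F x + (- (3^-1 * T x * T x) *: e + (3^-1 * T x) *: x).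
  by rewrite /P !bE (symbilC bP x e) be; apply/rowP=> k; rewrite !mxE; field.
rewrite bxP FxP bxPx !PE Pe (PZ (3^-1 * T x)) in sum_eq.
move: sum_eq; rewrite /base_factor -/(tr x).
move: (P x) (P (F x)) (tr x) => p q r; rewrite !mxE => sum_eq.
apply: (mulfI n_neq0); rewrite !mulrA mulfV // mul1r.
move/eqP: sum_eq; rewrite -subr_eq0 => /eqP sum_eq.
by apply/eqP; rewrite -subr_eq0 -sum_eq; apply/eqP; field.
Qed.

(* Where the linear form [base_factor] vanishes, [F x] is a multiple of [e], and
   [G (F x) = N x *: x] forces [F x = 0]; hence the form divides [F]. *)
Lemma base_factor_dvd : (forall i j x, base_minor i j x = 0) ->
  forall x, F x = base_factor x *: (x - (T x + base_factor x) *: e).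
Proof.
move=> M0; have a_lin := base_factor_scalar; have ae := base_factor_base.
have ker0 x : base_factor x = 0 -> F x = 0.
  move=> ax; have := base_projF M0 x; rewrite ax scale0r {1}/P => /subr0_eq Fx.
  have := GF x; rewrite Fx; set r := 3^-1 * _.
  have cee : c e e = 2 *: e by rewrite -[in RHS]Ge; apply/rowP=> k; rewrite !mxE; field.
  rewrite !cE cee !scalerA => re.
  (* If [r] were nonzero, [e] would be a multiple of [x], and [base_factor] would vanish at [e]
     instead of being -1. *)
  have [->|r0] := eqVneq r 0; first by rewrite scale0r.
  have eE : e = (r^-1 * r^-1 * N x) *: x + 0.
    rewrite addr0 -[_ *: x]scalerA -re !scalerA.
    by rewrite -[LHS]scale1r; congr (_ *: _); field.
  have := ae; rewrite eE a_lin ax mulr0 add0r.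
  have := a_lin (-1) 0 0; rewrite scaler0 addr0 mulN1r addNr => ->.
  by move/eqP; rewrite eq_sym oppr_eq0 oner_eq0.
move=> x; set a := base_factor x.
(* Since [base_factor e = -1], this translate of [x] lies in the kernel of the form; expanding [F]
   there gives the factorization. *)
have : F (a *: e + x) = 0 by apply: ker0; rewrite a_lin ae /a; ring.
rewrite !bE !(symbilC bP x e) !be Te => /rowP H.
apply/rowP=> k; apply/eqP; rewrite -subr_eq0; have := H k; rewrite !mxE => Hk.
by rewrite -[X in _ == X]Hk; apply/eqP; field.
Qed.

Let polyfun_F k : polyfun (fun x => F x 0 k).
Proof.
apply: (@polyfun_bilinear _ _ (fun x y => (2^-1 *: b x y) 0 k) id id) => [y|x|i|i].
- by move=> a x z; rewrite !bE !mxE; ring.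
- by move=> a y z; rewrite !bE !mxE; ring.
- exact: polyfun_coord.
- exact: polyfun_coord.
Qed.

Lemma polyfun_base_minor i j : polyfun (base_minor i j).
Proof.
have pP (u : V -> V) : (forall k, polyfun (fun x => u x 0 k)) ->
    forall k, polyfun (fun x => P (u x) 0 k).
  move=> pu k; apply: (polyfun_scalar (f := fun y => P y 0 k)) => // a y z.
  by rewrite PE; move: (P _) (P _) => p q; rewrite !mxE.
have pid k : polyfun (fun x => P x 0 k) by apply: (pP id) => i'; apply: polyfun_coord.
have pF k : polyfun (fun x => P (F x) 0 k) by exact: (pP (fun x => F x)).
exact: (polyfunB (polyfunM (pF i) (pid j)) (polyfunM (pF j) (pid i))).
Qed.

(** Put [s = S x - T (F x)]. Writing [G] as [F] plus a multiple of [e] in both compositions yields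
    two expressions for [F (F x)]; their difference is a relation among [e], [x], [F x] in which
    [F x] has coefficient [- s]. Hence [s] is zero at generic points, and everywhere by density. *)
Lemma inverse_eq (M : V -> K) i0 j0 x0 :
  (forall x, F (G x) = M x *: x) -> base_minor i0 j0 x0 != 0 ->
  forall x, G x = F x /\ T (F x) = S x.
Proof.
move=> FG M0 x; suff s0 : S x - T (F x) = 0.
  by rewrite inverse_sub_base s0 scale0r addr0; split=> //; apply/esym/subr0_eq.
move: x; apply: (polyfun_dense (f := base_minor i0 j0) (x0 := x0)) => //.
- exact: polyfun_base_minor.
- apply: (@polyfunB _ _ (fun x => S x) (fun x => T (F x)));
    last exact: (polyfun_scalar (f := fun x => T x)).
  apply: (@polyfun_bilinear _ _ (fun x y => 2^-1 * t e x y) id id) => [y|x|i|i].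
  - by move=> a x z; rewrite !tE; ring.
  - by move=> a y z; rewrite !tE; ring.
  - exact: polyfun_coord.
  - exact: polyfun_coord.
move=> x Mx; set s := S x - T (F x).
have := FG x; rewrite inverse_sub_base -/s.
have := GF x; rewrite inverse_sub_base; set s' := S (F x) - _.
move=> GFx FGx.
suff : (s * T (F x) + s ^+ 2 - s') *: e + (N x - M x) *: x + (- s) *: F x = 0.
  by case/(base_minor_free Mx) => _ _ /eqP; rewrite oppr_eq0 => /eqP.
have FD y : 2^-1 *: b (y + s *: e) (y + s *: e) =
    F y + s *: (T y *: e - y) + s ^+ 2 *: F e.
  rewrite !bE !(symbilC bP y e) !be Te.
  by apply/rowP=> k; rewrite !mxE; field.
have := FD (F x); rewrite FGx Fe => FGx'.
have {}GFx : F (F x) = N x *: x - s' *: e by rewrite -GFx addrK.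
move: FGx'; rewrite GFx => /eqP; rewrite -subr_eq0 => /eqP/rowP H.
by apply/rowP => k; have := H k; rewrite !mxE => Hk; rewrite -[RHS]oppr0 -[X in _ = - X]Hk; field.
Qed.

End BirationalPair.

(** * Identities of the cubic adjoint and the Jordan product *)

Section CubicAdjoint.
Variables (K : numFieldType) (n : nat).
Notation V := 'rV[K]_n.
Variables (b : V -> V -> V) (t : V -> V -> V -> K) (e : V).
Hypotheses (bP : symbilinear b) (tP : symtrilinear t).

Notation F x := (2^-1 *: b x x).
Notation N x := (6^-1 * t x x x).
Notation T x := (2^-1 * t e e x).
Notation S x := (2^-1 * t e x x).

Hypotheses (FF : forall x, F (F x) = N x *: x).
Hypotheses (be : forall x, b e x = T x *: e - x) (teee : t e e e = 6).
Hypothesis TF : forall x, T (F x) = S x.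

Let bE := symbilE bP.
Let tE := symtriE tP.

Lemma trace_polar x y : t e e (b x y) = 2 * t e x y.
Proof.
have := TF (x + y); rewrite !bE !tE (symbilC bP y x) (symtriC23 tP e y x) => H.
have := TF x; have := TF y; rewrite !tE => Hy Hx.
apply/eqP; rewrite -subr_eq0; apply/eqP.
transitivity (2 * ((2^-1 * (2^-1 * (t e e (b x x) + t e e (b x y) +
  (t e e (b x y) + t e e (b y y)))) - 2^-1 * (t e x x + t e x y + (t e x y + t e y y)))
  - (2^-1 * (2^-1 * t e e (b x x)) - 2^-1 * t e x x)
  - (2^-1 * (2^-1 * t e e (b y y)) - 2^-1 * t e y y))); first by field.
by rewrite H Hx Hy; ring.
Qed.

(** Polarization of the second identity of [GF_polar] in the direction [e], all products with [e]
    being rewritten by [be]. *)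
Lemma adjoint_polar3 x y :
  b (F x) y + b x (b x y) + T x *: b x y =
  (T y * S x + T x * t e x y - 2^-1 * t x x y) *: e
   - T y *: F x - t e x y *: x - S x *: y.
Proof.
(* Subtracting the instances at [y] and at [e] from the one at [y + e] isolates the part bilinear in
   [y] and [e]. *)
have [_ H1] := GF_polar bP bP tP FF x (y + e).
have [_ H2] := GF_polar bP bP tP FF x y.
have [_ H3] := GF_polar bP bP tP FF x e.
have {}H1 : b (F x) (b e y) + b (b e x) (b x y) =
    2^-1 * t x x y *: e + 2^-1 * t x x e *: y + t x y e *: x.
  move/rowP: H1 => H1; move/rowP: H2 => H2; move/rowP: H3 => H3; apply/rowP=> k.
  move: (H1 k) (H2 k) (H3 k) => {H1 H2 H3}.
  rewrite !bE !(symbilC bP x e) !(symbilC bP y e) (symbilC bP (b x y) (b e x)).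
  rewrite !tE (symtriC23 tP x e y) !mxE.
  move=> /eqP; rewrite -subr_eq0 => /eqP H1 /eqP; rewrite -subr_eq0 => /eqP H2.
  move=> /eqP; rewrite -subr_eq0 => /eqP H3.
  apply/eqP; rewrite -subr_eq0; apply/eqP.
  transitivity (0 - 0 - 0 : K); last by rewrite !subr0.
  by rewrite -{1}H1 -{1}H2 -{1}H3; field.
move: H1; rewrite !be !bE (symbilC bP (b x x) e) !be !trace_polar.
rewrite (symtriC13 tP x x e) (symtriC13 tP x y e) (symtriC23 tP e y x).
move=> /rowP H; apply/rowP=> k; move: (H k); rewrite !mxE => {}H.
apply/eqP; rewrite -subr_eq0; apply/eqP; move/eqP: H; rewrite -subr_eq0 => /eqP H.
by rewrite -[RHS]oppr0 -[X in _ = - X]H; field.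
Qed.

(** The case [y = x] of [adjoint_polar3]: since [b x x] is twice [F x], the left side contains
    [b x (F x)] three times. *)
Lemma adjoint_self x : b x (F x) = (T x * S x - N x) *: e - T x *: F x - S x *: x.
Proof.
have := adjoint_polar3 x x; rewrite !bE (symbilC bP (b x x)) => /rowP H.
apply/rowP=> k; move: (H k); rewrite !mxE => {}H.
apply/eqP; rewrite -subr_eq0; apply/eqP; move/eqP: H; rewrite -subr_eq0 => /eqP H.
by rewrite -[RHS](mulr0 3^-1) -[X in _ = _ * X]H; field.
Qed.

Lemma trace_adjoint_self x : t e x (F x) = T x * S x - 3 * N x.
Proof.
have := trace_polar x (F x); rewrite adjoint_self => H.
apply: (mulfI (_ : 2 != 0)); first by rewrite Num.Theory.pnatr_eq0.
by rewrite -H !tE teee trace_polar; field.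
Qed.

(** This is the trace of the Jordan product of [x] and [y] constructed below. *)
Definition trace_form x y := T x * T y - t e x y.
Notation tf := trace_form.

(** [F (F (F x))] equals both [N (F x) *: F x] and [N x ^+ 2 *: F x], and [F x] is nonzero when
    [N x] is. *)
Lemma norm_adjoint x : N x != 0 -> N (F x) = N x ^+ 2.
Proof.
move=> Nx; have F0 : F 0 = 0 by rewrite (symbil0l bP) scaler0.
have Fn0 : F x != 0.
  apply: contraNneq Nx => Fx0; have := FF x; rewrite Fx0 F0 => /esym/eqP.
  rewrite scaler_eq0 => /orP[//|/eqP ->]; by rewrite (symtri0l tP) mulr0.
have := FF (F x); rewrite (FF x) !(symbilZl bP (N x)) !(symbilZr bP (N x)) => H.
apply/eqP; rewrite -subr_eq0.
have : (N (F x) - N x ^+ 2) *: F x == 0.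
  by rewrite scalerBl -H subr_eq0; apply/eqP/rowP=> k; rewrite !mxE; ring.
by rewrite scaler_eq0 (negPf Fn0) orbF.
Qed.

Lemma adjoint_twice x z : N x != 0 ->
  N x *: b x (b (F x) z) = N x ^+ 2 *: z + (2^-1 * t (F x) (F x) z) *: F x.
Proof.
move=> Nx; have [] := GF_polar bP bP tP FF (F x) z.
by rewrite FF norm_adjoint // !(symbilZl bP (N x)).
Qed.

(* Both compositions of [b x] and [b (F x)] are scalar up to rank one, while
   [adjoint_polar3] computes their commutator; compare the coefficients of [F x]. *)
Lemma norm_deriv_adjoint x z i j : N x != 0 -> base_minor b t e i j x != 0 ->
  2^-1 * t (F x) (F x) z = N x * tf x z.
Proof.
move=> Nx Mx; set D' := 2^-1 * t _ _ z; have [f fE] : exists f, f = F x by exists (F x).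
have H5 := adjoint_self x; rewrite -fE in H5.
have H1 := adjoint_polar3 x z; rewrite -fE in H1.
have := adjoint_polar3 x (b x z); rewrite (GF_polar bP bP tP FF x z).1 trace_polar -fE.
set u2 := _ * S x + _ - _; move=> /rowP H2.
have H3 := adjoint_twice z Nx; rewrite -/D' -fE in H3.
set u1 := T z * S x + _ - _ in H1.
(* Substituting this into [H3] produces the triple product [b x (b x (b x z))], which [H2]
   eliminates. *)
have bFz : b f z = u1 *: e - T z *: f - t e x z *: x - S x *: z - b x (b x z) - T x *: b x z.
  by rewrite -H1; apply/rowP=> k; rewrite !mxE; ring.
rewrite bFz !bE (symbilC bP x e) be H5 in H3.
suff : (N x * (u1 * T x - u2 - T z * (T x * S x - N x))) *: e +
    (N x * (T z * S x + t e x (b x z) + 2^-1 * t x x z - u1)) *: x +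
    (N x * tf x z - D') *: f = 0.
  by rewrite fE; case/(base_minor_free tP teee Mx) => _ _ /subr0_eq.
move/rowP: H3 => H3; apply/rowP=> k; move: (H2 k) (H3 k).
have fx : b x x 0 k = 2 * f 0 k by rewrite fE !mxE; field.
rewrite /trace_form; clearbody u1 u2 D'; rewrite !mxE fx.
move=> /eqP; rewrite -subr_eq0 => /eqP {}H2 /eqP; rewrite -subr_eq0 => /eqP {}H3.
transitivity (N x * 0 + 0); last by rewrite mulr0 addr0.
by rewrite -{1}H2 -{1}H3; field.
Qed.

Variables (i0 j0 : 'I_n) (x0 : V).
Hypothesis M0 : base_minor b t e i0 j0 x0 != 0.

Let Ne : N e != 0.
Proof. by rewrite teee mulVf ?oner_eq0 // Num.Theory.pnatr_eq0. Qed.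

Let polyfun_bb (f : V -> V -> K) :
  (forall y, scalar (f^~ y)) -> (forall x, scalar (f x)) -> polyfun (fun x => f x x).
Proof.
by move=> fl fr; apply: (@polyfun_bilinear _ _ f id id) => // i; apply: polyfun_coord.
Qed.

Let polyfun_b (u v : V -> V) k : (forall i, polyfun (fun x => u x 0 i)) ->
  (forall i, polyfun (fun x => v x 0 i)) -> polyfun (fun x => b (u x) (v x) 0 k).
Proof.
move=> pu pv; apply: (@polyfun_bilinear _ _ (fun x y => b x y 0 k) u v) => // z a x y.
  by rewrite !bE !mxE.
by rewrite !bE !mxE.
Qed.

Let polyfun_F k : polyfun (fun x => F x 0 k).
Proof.
apply: (@polyfun_bb (fun x y => (2^-1 *: b x y) 0 k)) => z a x y; rewrite !bE !mxE; ring.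
Qed.

Let polyfun_t z (u v : V -> V) : (forall i, polyfun (fun x => u x 0 i)) ->
  (forall i, polyfun (fun x => v x 0 i)) -> polyfun (fun x => t (u x) (v x) z).
Proof.
by move=> pu pv; apply: (@polyfun_bilinear _ _ (fun x y => t x y z) u v) => // w a x y; rewrite !tE.
Qed.

Let polyfun_N : polyfun (fun x => N x).
Proof.
apply: (@polyfun_ext _ _ (fun x => 6^-1 * \sum_i x 0 i * t x x (delta_mx 0 i))).
  move=> x; congr (_ * _); rewrite -(@scalar_delta _ _ (t x x)) // => a y z.
  by rewrite !tE.
apply: polyfunM; first exact: polyfun_const.
apply: polyfun_sum => i; apply: polyfunM; first exact: polyfun_coord.
by apply: (@polyfun_t _ id id) => j; apply: polyfun_coord.
Qed.

Let polyfun_id i : polyfun (fun x : V => x 0 i). Proof. exact: polyfun_coord. Qed.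

Let polyfun_tf z (u : V -> V) : (forall i, polyfun (fun x => u x 0 i)) ->
  polyfun (fun x => tf (u x) z).
Proof.
move=> pu; apply: (polyfun_scalar (f := fun x => tf x z)) => // a x y.
by rewrite /tf !tE; ring.
Qed.

(** The dual identity is first freed from the minor by density. Taken at [F x], where
    [F (F x) = N x *: x], it becomes the present identity multiplied by [N x ^+ 2]; this factor is
    cancelled and density in [N] finishes. *)
Lemma norm_deriv x z : 2^-1 * t x x z = tf (F x) z.
Proof.
have dual y w : N y != 0 -> 2^-1 * t (F y) (F y) w = N y * tf y w.
  (* The factor [N y] makes the difference vanish also at points of zero norm, so that only the
     minor restricts [y]. *)
  move=> Ny; apply/eqP; rewrite -subr_eq0 -(mulrI_eq0 _ (mulfI Ny)); apply/eqP.
  move: y {Ny}; apply: (@polyfun_dense _ _ (base_minor b t e i0 j0) _ x0) => //.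
  - exact: polyfun_base_minor.
  - apply: (@polyfunM _ _ (fun x => N x)) => //.
    apply: (@polyfunB _ _ (fun y => 2^-1 * t (F y) (F y) w) (fun y => N y * tf y w)).
      by apply: polyfunM; [apply: polyfun_const|apply: polyfun_t].
    by apply: (@polyfunM _ _ (fun x => N x)) => //; apply: (@polyfun_tf w id).
  - move=> y My; have [->|Ny] := eqVneq (N y) 0; first by rewrite mul0r.
    by rewrite (norm_deriv_adjoint w Ny My) subrr mulr0.
apply/eqP; rewrite -subr_eq0; apply/eqP.
move: x; apply: (@polyfun_dense _ _ (fun x => N x) _ e) => //.
  apply: (@polyfunB _ _ (fun x => 2^-1 * t x x z) (fun x => tf (F x) z)).
    by apply: polyfunM; [apply: polyfun_const|apply: (@polyfun_t z id id)].
  exact: (@polyfun_tf z (fun x => F x)).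
move=> x Nx; have NFx : N (F x) != 0 by rewrite norm_adjoint // expf_neq0.
apply: (mulfI (expf_neq0 2 Nx)); rewrite mulr0 mulrBr.
have := dual (F x) z NFx; rewrite FF norm_adjoint // !tE => <-.
by ring.
Qed.

Lemma adjoint_compl x y : b (F x) (b x y) = N x *: y + tf (F x) y *: x.
Proof. by rewrite (GF_polar bP bP tP FF x y).1 norm_deriv. Qed.

(** Where [N x] is nonzero it is cancelled from [adjoint_twice], with [norm_deriv] at [F x] giving
    the rank one term; density does the rest. *)
Lemma adjoint_compr x y : b x (b (F x) y) = N x *: y + tf x y *: F x.
Proof.
apply/rowP=> k; apply/eqP; rewrite -subr_eq0; apply/eqP.
move: x; apply: (@polyfun_dense _ _ (fun x => N x) _ e) => //.
  apply: (@polyfunB _ _ (fun x => b x (b (F x) y) 0 k) (fun x => (N x *: y + tf x y *: F x) 0 k)).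
    apply: (@polyfun_b id (fun x => b (F x) y)) => // i.
    by apply: (@polyfun_b (fun x => F x) (fun=> y)) => // j; apply: polyfun_const.
  apply: (@polyfun_ext _ _ (fun x => N x * y 0 k + tf x y * F x 0 k)).
    by move=> x; rewrite !mxE.
  apply: polyfunD; first by apply: (@polyfunM _ _ (fun x => N x)) => //; apply: polyfun_const.
  by apply: polyfunM => //; apply: (@polyfun_tf y id).
move=> x Nx; apply/eqP; rewrite subr_eq0; apply/eqP; move: k; apply/rowP.
apply: (scalerI Nx); rewrite adjoint_twice // norm_deriv FF scalerDr !scalerA.
by rewrite /tf !tE; congr (_ + _ *: _); ring.
Qed.

(** Polarization of the square [x^2 = F x + T x *: x - S x *: e], that is, of the definition of the
    adjoint solved for [x^2]. *)
Definition jordan_prod x y := 2^-1 *: (b x y + T x *: y + T y *: x - t e x y *: e).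
Notation m := jordan_prod.

Lemma jordan_prod_symbilinear : symbilinear m.
Proof.
split=> [x y|y a x z].
  by rewrite /m (symbilC bP x) (symtriC23 tP e x); congr (_ *: (_ - _)); rewrite addrAC.
by rewrite /m !bE !tE; apply/rowP=> k; rewrite !mxE; ring.
Qed.

Let mE := symbilE jordan_prod_symbilinear.

Lemma jordan_prod_unit x : m e x = x.
Proof. by rewrite /m be teee; apply/rowP=> k; rewrite !mxE; field. Qed.

Lemma jordan_prod_sq x : m x x = F x + T x *: x - S x *: e.
Proof. by rewrite /m; apply/rowP=> k; rewrite !mxE; field. Qed.

Lemma trace_compl x y : t e (F x) (b x y) = N x * T y + tf (F x) y * T x.
Proof.
apply: (mulfI (_ : 2 != 0)); first by rewrite Num.Theory.pnatr_eq0.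
by rewrite -trace_polar adjoint_compl !tE; field.
Qed.

Lemma trace_compr x y : t e x (b (F x) y) = N x * T y + tf x y * S x.
Proof.
apply: (mulfI (_ : 2 != 0)); first by rewrite Num.Theory.pnatr_eq0.
by rewrite -trace_polar adjoint_compr !(symtriDr tP) !(symtriZr tP) trace_polar; field.
Qed.

Lemma jordan_prod_adjoint x : m x (F x) = N x *: e.
Proof.
rewrite /m adjoint_self TF trace_adjoint_self.
by apply/rowP=> k; rewrite !mxE; field.
Qed.

(* Modulo [x] and [e], which commute with [x], the square of [x] is [F x]. *)
Lemma jordan_prod_jordan x y : m (m x x) (m x y) = m x (m (m x x) y).
Proof.
(* Multiplications by [x] and [F x] commute: after expansion the only iterated products are those of
   [adjoint_compl] and [adjoint_compr]. *)
have mF : m (F x) (m x y) = m x (m (F x) y).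
  have cl := adjoint_compl x y; have cr := adjoint_compr x y.
  have tl := trace_compl x y; have tr := trace_compr x y.
  have tb := trace_polar x y; have tb' := trace_polar (F x) y.
  have TFx := TF x; have := jordan_prod_adjoint x.
  rewrite symbilC; last exact: jordan_prod_symbilinear.
  rewrite /trace_form in cl cr tl tr.
  move: (F x) cl cr tl tr tb tb' TFx => f cl cr tl tr tb tb' TFx mfx.
  have -> : m f (m x y) = 2^-1 *: (m f (b x y) + T x *: m f y + T y *: m f x - t e x y *: f).
    by rewrite {2}/m !mE (symbilC jordan_prod_symbilinear f e) jordan_prod_unit.
  have -> : m x (m f y) = 2^-1 *: (m x (b f y) + T f *: m x y + T y *: m x f - t e f y *: x).
    by rewrite {2}/m !mE (symbilC jordan_prod_symbilinear x e) jordan_prod_unit.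
  rewrite (symbilC jordan_prod_symbilinear x f) /m cl cr tl tr tb tb' TFx.
  by apply/rowP=> k; rewrite !mxE; field.
rewrite jordan_prod_sq !(symbilDl jordan_prod_symbilinear) !(symbilNl jordan_prod_symbilinear).
rewrite !(symbilZl jordan_prod_symbilinear (T x)) !(symbilZl jordan_prod_symbilinear (S x)).
rewrite !jordan_prod_unit mF.
rewrite !(symbilDr jordan_prod_symbilinear) !(symbilNr jordan_prod_symbilinear).
by rewrite !(symbilZr jordan_prod_symbilinear (T x)) !(symbilZr jordan_prod_symbilinear (S x)).
Qed.

Lemma jordan_prod_cube x : m x (m x x) = T x *: m x x - S x *: x + N x *: e.
Proof.
rewrite {1}jordan_prod_sq !(symbilDr jordan_prod_symbilinear) !(symbilNr jordan_prod_symbilinear).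
rewrite jordan_prod_adjoint !(symbilZr jordan_prod_symbilinear (T x)).
rewrite !(symbilZr jordan_prod_symbilinear (S x)).
rewrite (symbilC jordan_prod_symbilinear x e) jordan_prod_unit.
by move: (m x x) => u; apply/rowP=> k; rewrite !mxE; ring.
Qed.

End CubicAdjoint.

(** * Subalgebras generated by one element and the rank *)

Section PowerSpan.
Variables (K : numFieldType) (n : nat) (c : sconst K n) (e : 'rV[K]_n).
Hypothesis jordan_c : is_jordan c e.

Lemma amul_symbilinear : symbilinear (amul c).
Proof.
split=> [x y|z a x y]; first by have [] := jordan_c.
apply/rowP=> k; rewrite !mxE mulr_sumr -big_split; apply: eq_bigr => i _ /=.
rewrite mulr_sumr -big_split; apply: eq_bigr => j _ /=; rewrite !mxE; ring.
Qed.

Let amE := symbilE amul_symbilinear.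

Hypothesis cube : forall x, exists u v w,
  amul c x (amul c x x) = u *: amul c x x + v *: x + w *: e.

Definition power_span x : 'M[K]_n := (e + (x + amul c x x))%MS.

Lemma power_spanP x u :
  reflect (exists v1 v2 v3, u = v1 *: e + (v2 *: x + v3 *: amul c x x)) (u <= power_span x)%MS.
Proof.
apply: (iffP idP) => [/sub_addsmxP[[u1 u2] ->]|[v1 [v2 [v3 ->]]]].
  have /sub_addsmxP[[u3 u4] /= ->] : (u2 *m (x + amul c x x)%MS <= x + amul c x x)%MS.
    exact: submxMl.
  exists (u1 0 0), (u3 0 0), (u4 0 0).
  by rewrite /= [u1]mx11_scalar [u3]mx11_scalar [u4]mx11_scalar !mul_scalar_mx !mxE.
apply: addmx_sub_adds; first exact: scalemx_sub.
by apply: addmx_sub_adds; apply: scalemx_sub.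
Qed.

Lemma power_span_subalg x : is_subalg c (power_span x).
Proof.
move=> _ _ /power_spanP[a1 [a2 [a3 ->]]] /power_spanP[b1 [b2 [b3 ->]]].
have [amC [am1 amJ]] := jordan_c.
have [u [v [w xp]]] := cube x.
set p := amul c x x in xp *.
(* The Jordan identity with [y = x] gives [x^2 x^2 = x (x^2 x)], so the cubic relation, used twice,
   reduces the fourth power. *)
have pp : amul c p p = u *: (u *: p + v *: x + w *: e) + v *: p + w *: x.
  by rewrite /p amJ -/p (amC p x) xp !amE -/p (amC x e) am1 xp.
apply/power_spanP; rewrite -/p.
exists (a1 * b1 + (a2 * b3 + a3 * b2) * w + a3 * b3 * u * w).
exists (a1 * b2 + a2 * b1 + (a2 * b3 + a3 * b2) * v + a3 * b3 * (u * v + w)).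
exists (a1 * b3 + a3 * b1 + a2 * b2 + (a2 * b3 + a3 * b2) * u + a3 * b3 * (u * u + v)).
rewrite !amE (amC p x) (amC x e) (amC p e) !am1 xp pp -/p.
by clearbody p; apply/rowP=> k; rewrite !mxE; ring.
Qed.

Lemma power_span_min x (U : 'M[K]_n) :
  is_subalg c U -> (e <= U)%MS -> (x <= U)%MS -> (power_span x <= U)%MS.
Proof. by move=> algU eU xU; rewrite !addsmx_sub eU xU algU. Qed.

Lemma power_span_gens x : (e <= power_span x)%MS /\ (x <= power_span x)%MS.
Proof.
by split; [exact: addsmxSl|exact: submx_trans (addsmxSl _ _) (addsmxSr _ _)].
Qed.

(** The cubic relation makes [power_span y] the subalgebra generated by [e] and [y], of dimension at
    most 3; the free triple at [x] attains the bound. *)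
Lemma alg_rank3 x :
  (forall u v w, u *: e + v *: x + w *: amul c x x = 0 -> [/\ u = 0, v = 0 & w = 0]) ->
  alg_rank c e 3.
Proof.
move=> free_x.
have rank_le y : (\rank (power_span y) <= 3)%N.
  have le1 (z : 'rV[K]_n) : (\rank z <= 1)%N by exact: rank_leq_row.
  apply: leq_trans (mxrank_adds_leqif _ _).1 _.
  rewrite -[3%N]/(1 + (1 + 1))%N leq_add //.
  by apply: leq_trans (mxrank_adds_leqif _ _).1 _; rewrite leq_add.
have rank_x : \rank (power_span x) = 3.
  apply/eqP; rewrite eqn_leq rank_le /=.
  pose B := col_mx e (col_mx x (amul c x x)).
  have freeB : row_free B.
    apply: inj_row_free => v; rewrite -[v]hsubmxK -[rsubmx v]hsubmxK !mul_row_col.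
    rewrite [lsubmx v]mx11_scalar [lsubmx (rsubmx v)]mx11_scalar [rsubmx (rsubmx v)]mx11_scalar.
    rewrite !mul_scalar_mx addrA => /free_x[-> -> ->].
    by rewrite !raddf0 !row_mx0.
  suff : (\rank B <= \rank (power_span x))%N by rewrite (eqP freeB).
  have [ex xx] := power_span_gens x; apply: mxrankS; rewrite !col_mx_sub ex xx /=.
  exact: submx_trans (addsmxSr _ _) (addsmxSr _ _).
split=> [|y d [_ min_y]].
  exists x; split.
    exists (power_span x); have [ex xx] := power_span_gens x.
    by split; [exact: power_span_subalg|].
  by move=> U algU eU xU; have := mxrankS (power_span_min algU eU xU); rewrite rank_x.
apply: leq_trans (rank_le y); have [ey yy] := power_span_gens y.
by apply: min_y => //; exact: power_span_subalg.
Qed.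

End PowerSpan.

(** * Passage between polynomial maps and multilinear functions *)

Section PolynomialMaps.
Variables (K : numFieldType) (n : nat).
Notation V := 'rV[K]_n.
Implicit Types (f g : polymap K n) (x y : V).

Lemma amul_symbilinearE (m : V -> V -> V) : symbilinear m ->
  forall x y, amul (fun i j k => m (delta_mx 0 i) (delta_mx 0 j) 0 k) x y = m x y.
Proof.
move=> mP x y; rewrite [RHS](linear_delta (mP.2 y)); apply/rowP=> k.
rewrite mxE summxE; apply: eq_bigr => i _; rewrite (symbilC mP _ y) (linear_delta (mP.2 _)).
rewrite mxE summxE mulr_sumr; apply: eq_bigr => j _; rewrite mxE (symbilC mP (delta_mx 0 j)); ring.
Qed.

Definition pmeval f x : V := \row_k peval (f k) x.

Definition pmpolar f x y : V := \row_k polar2 (f k) x y.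

Lemma pmpolar_symbilinear f : quadratic_map f -> symbilinear (pmpolar f).
Proof.
move=> qf; split=> [x y|y a x z]; apply/rowP=> k; rewrite !mxE.
  by rewrite /polar2 [y + x]addrC; ring.
by have [-> _] := polar2_homog (qf k).
Qed.

Lemma pmevalE f x : quadratic_map f -> pmeval f x = 2^-1 *: pmpolar f x x.
Proof.
move=> qf; apply/rowP=> k; rewrite !mxE; have [_ ->] := polar2_homog (qf k).
by field.
Qed.

Lemma peval_pmcomp f g i x : peval (pmcomp f g i) x = peval (f i) (pmeval g x).
Proof.
rewrite /peval /pmcomp comp_mpoly_meval; apply: meval_eq => j.
by rewrite tnth_mktuple !mxE.
Qed.

Lemma peval_plin (A : 'M[K]_n) i x : peval (plin A i) x = \sum_j A i j * x 0 j.
Proof.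
rewrite /peval /plin raddf_sum; apply: eq_bigr => j _ /=.
by rewrite mevalZ mevalXU.
Qed.

Lemma mulmx_linear (h : V -> V) : linear h ->
  forall x, x *m (\matrix_(i, j) h (delta_mx 0 i) 0 j) = h x.
Proof.
move=> hlin x; rewrite (linear_delta hlin); apply/rowP=> k; rewrite !mxE summxE.
by apply: eq_bigr => i _; rewrite !mxE.
Qed.

Lemma unitmx_ker0 (A : 'M[K]_n) : (forall x, x *m A = 0 -> x = 0) -> A \in unitmx.
Proof. by move=> A0; rewrite -row_free_unit; apply: inj_row_free. Qed.

(** For [n = 1] the single component is its own common factor, hence constant, hence zero as a
    quadratic form; but then ['X_ord0] is a common factor too. For [n = 0] there is no index to
    carry a nonzero component. *)
Lemma Bir22_dim f : Bir22 f -> (1 < n)%N.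
Proof.
case: n f => [|[|//]] f [qf [nf [g [qg [ng [[[i fg0] _] _]]]]]]; first by case: i fg0.
have f_div i' : exists r, f i' = f ord0 * r by exists 1; rewrite mulr1 [i']ord1.
have f0 : f ord0 = 0.
  have := msize1_polyC (nf _ f_div) => f0C; apply/mpolyP => m; rewrite f0C mcoeffC mcoeff0.
  by rewrite (dhomog_nemf_coeff (qf ord0)) ?mulr0 ?mul0r //= mdeg0.
have /nf : forall i', exists r, f i' = 'X_ord0 * r by move=> i'; exists 0; rewrite mulr0 [i']ord1.
by rewrite msizeX mdeg1.
Qed.

Lemma same_ratmap_pmid f g : (1 < n)%N -> same_ratmap (pmcomp g f) (@pmid K n) ->
  exists q, forall i, pmcomp g f i = q * 'X_i.
Proof. by move=> n_gt1 [_ [_ gfX]]; apply: mpolyX_dvd_family => // i j; apply: gfX. Qed.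

Definition linpoly (h : V -> K) : {mpoly K[n]} := \sum_i h (delta_mx 0 i) *: 'X_i.

Lemma peval_linpoly h x : scalar h -> peval (linpoly h) x = h x.
Proof.
move=> hlin; rewrite (scalar_delta hlin) /peval raddf_sum; apply: eq_bigr => i _ /=.
by rewrite mevalZ mevalXU mulrC.
Qed.

Lemma linpoly_homog h : linpoly h \is 1.-homog.
Proof. by apply: rpred_sum => i _; apply: dhomogZ; rewrite dhomogX /= mdeg1. Qed.

Definition quadpoly (h : V -> V -> K) : {mpoly K[n]} :=
  \sum_i \sum_j h (delta_mx 0 i) (delta_mx 0 j) *: ('X_i * 'X_j).

Lemma peval_quadpoly h x : (forall y, scalar (h^~ y)) -> (forall y, scalar (h y)) ->
  peval (quadpoly h) x = h x x.
Proof.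
move=> hl hr; rewrite (scalar_delta (hl x)) /peval raddf_sum; apply: eq_bigr => i _ /=.
rewrite (scalar_delta (hr _)) raddf_sum mulr_sumr; apply: eq_bigr => j _ /=.
by rewrite mevalZ mevalM !mevalXU; ring.
Qed.

Lemma quadpoly_homog h : quadpoly h \is 2.-homog.
Proof.
apply: rpred_sum => i _; apply: rpred_sum => j _; apply: dhomogZ.
by apply: (@dhomogM _ _ _ 1 _ 1); rewrite dhomogX /= mdeg1.
Qed.

End PolynomialMaps.

(** * Normalization of a quadro-quadric map at a base point *)

Section Normalization.
Variables (K : numFieldType) (n : nat).
Notation V := 'rV[K]_n.

(* Composing [f] on the left with [A] makes the polarization of [f] at the base point [e]
   equal to [x |-> T x *: e - x], as for the adjoint of a rank 3 Jordan algebra. *)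
Lemma Bir22_normalization (f : polymap K n) : Bir22 f ->
  exists (A : 'M[K]_n) (b c : V -> V -> V) (t : V -> V -> V -> K) (e : V)
    (M : V -> K) (p : {mpoly K[n]}),
  [/\ [/\ A \in unitmx, symbilinear b, symbilinear c & symtrilinear t],
      p \is 3.-homog, forall x, peval p x = 6^-1 * t x x x,
      forall x, 2^-1 *: b x x = pmeval f x *m A &
   [/\ forall x, 2^-1 *: c (2^-1 *: b x x) (2^-1 *: b x x) = (6^-1 * t x x x) *: x,
       forall x, 2^-1 *: b (2^-1 *: c x x) (2^-1 *: c x x) = M x *: x,
       forall x, b e x = (2^-1 * t e e x) *: e - x & t e e e = 6]].
Proof.
move=> bir_f; have n_gt1 := Bir22_dim bir_f.
case: bir_f => qf [nf [g [qg [ng [gfX fgX]]]]].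
have [N0 gfN] := same_ratmap_pmid n_gt1 gfX; have [M0 fgM] := same_ratmap_pmid n_gt1 fgX.
have hN0 : N0 \is 3.-homog.
  by apply: (@dhomog_divX _ _ _ (Ordinal n_gt1)); rewrite -gfN; apply: dhomog_pmcomp.
have [t0P t0N] := polar3_homog hN0.
have bfP := pmpolar_symbilinear qf; have bgP := pmpolar_symbilinear qg.
have gf x : pmeval g (pmeval f x) = peval N0 x *: x.
  by apply/rowP=> k; rewrite !mxE -peval_pmcomp gfN pevalM pevalX.
have fg x : pmeval f (pmeval g x) = peval M0 x *: x.
  by apply/rowP=> k; rewrite !mxE -peval_pmcomp fgM pevalM pevalX.
have [e Ne] : exists e, peval N0 e != 0.
  apply: contrapT => /forallNP Nz; have N00 : N0 = 0.
    by apply: peval_inj => x; rewrite peval0; have /negP := Nz x; rewrite negbK => /eqP.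
  by case: gfX => [[i +] _]; rewrite gfN N00 mul0r eqxx.
set k := peval N0 e in Ne.
(* Dividing by [k] gives the cubic form the value 1 at [e]. *)
pose t x y z := k^-1 * polar3 N0 x y z.
have tP : symtrilinear t.
  split=> [x y z|x y z|y z a x x']; rewrite /t; first by rewrite (symtriC12 t0P).
    by rewrite (symtriC23 t0P).
  by rewrite !(symtriE t0P); ring.
have tN x : 6^-1 * t x x x = k^-1 * peval N0 x by rewrite /t t0N; field.
have teee : t e e e = 6 by rewrite /t t0N -/k; field.
have e0 : e != 0.
  by apply: contra_eq_neq teee => ->; rewrite (symtri0l tP) eq_sym Num.Theory.pnatr_eq0.
pose T x := 2^-1 * t e e x.
have Te : T e = 3 by rewrite /T teee; field.
have TE a x y : T (a *: x + y) = a * T x + T y by rewrite /T !(symtriE tP); ring.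
pose h x := T x *: e - x.
have h_lin : linear h.
  by move=> a x y; rewrite /h TE; apply/rowP=> j; rewrite !mxE; ring.
pose L := \matrix_(i, j) pmpolar f e (delta_mx 0 i) 0 j.
pose H := \matrix_(i, j) h (delta_mx 0 i) 0 j.
have LE x : x *m L = pmpolar f e x.
  apply: (@mulmx_linear _ _ (pmpolar f e)) => a y z; by rewrite !(symbilE bfP).
have HE x : x *m H = h x by exact: mulmx_linear.
have fe0 : pmeval f e != 0.
  apply: contraNneq Ne => fe; have := gf e; rewrite fe (pmevalE _ qg) (symbil0l bgP) scaler0.
  by move=> /esym/eqP; rewrite scaler_eq0 (negPf e0) orbF.
(* If the derivative of [f] at [e] kills [x], the first-order identity makes [x] a multiple of [e];
   but at [e] that derivative is twice the nonzero vector [pmeval f e]. *)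
have L_unit : L \in unitmx.
  apply: unitmx_ker0 => x; rewrite LE => Lx.
  have GF y : 2^-1 *: pmpolar g (2^-1 *: pmpolar f y y) (2^-1 *: pmpolar f y y) =
      (6^-1 * polar3 N0 y y y) *: y.
    rewrite -!pmevalE // gf t0N; congr (_ *: _); by field.
  have [] := GF_polar bfP bgP t0P GF e x; rewrite Lx (symbilC bgP) (symbil0l bgP).
  set d := 2^-1 * _; have -> : 6^-1 * polar3 N0 e e e = k by rewrite t0N -/k; field.
  move=> /esym kx _; have xE : x = (- (k^-1 * d)) *: e.
    have : k^-1 *: (k *: x + d *: e) = 0 by rewrite kx scaler0.
    rewrite scalerDr !scalerA mulVf // scale1r => /eqP; rewrite addr_eq0 => /eqP ->.
    by rewrite scaleNr.
  move: Lx; rewrite xE (symbilZr bfP).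
  have -> : pmpolar f e e = 2 *: pmeval f e.
    by rewrite pmevalE // scalerA mulfV ?scale1r // Num.Theory.pnatr_eq0.
  move=> /eqP; rewrite !scaler_eq0 (negPf fe0) Num.Theory.pnatr_eq0 !orbF => /eqP ->.
  by rewrite scale0r.
(* Applying [T] to [x = T x *: e] gives [T x = 3 * T x], so [T x = 0] and [x = 0]. *)
have H_unit : H \in unitmx.
  apply: unitmx_ker0 => x; rewrite HE => /eqP; rewrite subr_eq0 => /eqP xE.
  have T0 : T 0 = 0 by rewrite /T (symtriC13 tP) (symtri0l tP) mulr0.
  have := congr1 T xE; rewrite -[T x *: e]addr0 TE Te T0 addr0 => Tx.
  have T0x : T x = 0.
    have : T x * 3 - T x = 0 by rewrite Tx subrr.
    have -> : T x * 3 - T x = T x * 2 by ring.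
    by move/eqP; rewrite mulf_eq0 Num.Theory.pnatr_eq0 orbF => /eqP.
  by rewrite -xE T0x scale0r.
pose A := invmx L *m H.
have A_unit : A \in unitmx by rewrite unitmx_mul unitmx_inv L_unit.
pose b x y := pmpolar f x y *m A.
(* The inverse absorbs [A] and is divided by [k] to match the rescaled cubic form. As [f] is
   quadratic, the other composition acquires the factor [k^-1 ^+ 2]. *)
pose c x y := k^-1 *: pmpolar g (x *m invmx A) (y *m invmx A).
have bE x : 2^-1 *: b x x = pmeval f x *m A by rewrite pmevalE // -scalemxAl.
have cE x : 2^-1 *: c x x = k^-1 *: pmeval g (x *m invmx A).
  by rewrite pmevalE // !scalerA mulrC.
exists A, b, c, t, e, (fun x => k^-1 ^+ 2 * peval M0 (x *m invmx A)), (k^-1 *: N0).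
split=> //; last first.
- split=> // x; last by rewrite /b -LE !mulmxA mulmxK // HE.
    by rewrite cE bE mulmxK // gf tN scalerA.
  rewrite bE cE; have -> : pmeval f (k^-1 *: pmeval g (x *m invmx A)) =
      k^-1 ^+ 2 *: pmeval f (pmeval g (x *m invmx A)).
    rewrite !(pmevalE _ qf) !(symbilZl bfP (k^-1)) !(symbilZr bfP (k^-1)).
    by apply/rowP=> j; rewrite !mxE; ring.
  by rewrite fg -!scalemxAl mulmxKV // scalerA.
- by move=> x; rewrite tN /peval mevalZ.
- exact: dhomogZ.
split=> //; split=> [x y|z a x y].
- by rewrite /b (symbilC bfP).
- by rewrite /b (symbilDl bfP) (symbilZl bfP) mulmxDl scalemxAl.
- by rewrite /c (symbilC bgP).
rewrite /c mulmxDl -scalemxAl (symbilDl bgP) (symbilZl bgP) scalerDr !scalerA.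
by rewrite mulrC.
Qed.

End Normalization.

(** * Generic independence and assembly of the Jordan algebra *)

Section JordanStructure.
Variables (K : numFieldType) (n : nat).
Notation V := 'rV[K]_n.

(** Otherwise the linear form [base_factor] divides every component of [f]. It is not constant,
    being -1 at [e] and 0 at the origin, which contradicts [no_common_factor]. *)
Lemma base_minor_exists (f : polymap K n) (A : 'M[K]_n) (b c : V -> V -> V)
    (t : V -> V -> V -> K) (e : V) :
  no_common_factor f -> A \in unitmx ->
  symbilinear b -> symbilinear c -> symtrilinear t ->
  (forall x, 2^-1 *: b x x = pmeval f x *m A) ->
  (forall x, 2^-1 *: c (2^-1 *: b x x) (2^-1 *: b x x) = (6^-1 * t x x x) *: x) ->
  (forall x, b e x = (2^-1 * t e e x) *: e - x) -> t e e e = 6 ->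
  exists i j x, base_minor b t e i j x != 0.
Proof.
move=> nf A_unit bP cP tP bf GF be teee; apply: contrapT => no_minor.
have M0 i j x : base_minor b t e i j x = 0.
  by apply/eqP; apply: contra_notT no_minor => Mn0; exists i, j, x.
have a_lin := base_factor_scalar e bP tP.
have ae := base_factor_base tP be teee.
have bdvd := base_factor_dvd bP cP tP GF be teee M0.
set a := base_factor b t e in a_lin ae bdvd.
have T_lin : scalar (fun x => 2^-1 * t e e x + a x).
  by move=> u x y; rewrite !(symtriE tP) a_lin; ring.
pose alpha := linpoly a.
(* Coordinates of the cofactor [x - (T x + a x) *: e] from [base_factor_dvd]; multiplying by
   [invmx A] returns to the components of [f]. *)
pose r i : {mpoly K[n]} := 'X_i + linpoly (fun x => - e 0 i * (2^-1 * t e e x + a x)).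
have er i x : peval (r i) x = x 0 i - (2^-1 * t e e x + a x) * e 0 i.
  rewrite -[r i]mul1r -[1 * _]addr0 /r mul1r addr0 /peval mevalD mevalXU -/(peval _ x).
  by rewrite peval_linpoly; [ring|move=> u y z; rewrite T_lin; ring].
have f_div i : exists q, f i = alpha * q.
  exists (\sum_j invmx A j i *: r j); apply: peval_inj => x.
  have -> : peval (f i) x = ((2^-1 *: b x x) *m invmx A) 0 i.
    by rewrite bf mulmxK // mxE.
  rewrite bdvd pevalM peval_linpoly // -scalemxAl mxE; congr (_ * _).
  rewrite mxE /peval raddf_sum; apply: eq_bigr => j _ /=.
  by rewrite mevalZ -/(peval _ x) er !mxE mulrC.
have alphaC := msize1_polyC (nf _ f_div).
have : peval alpha e = peval alpha 0 by rewrite alphaC /peval !mevalC.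
rewrite !peval_linpoly // ae.
have -> : a 0 = 0 by have := a_lin (-1) 0 0; rewrite scaler0 addr0 mulN1r addNr.
by move/eqP; rewrite oppr_eq0 oner_eq0.
Qed.

Lemma Bir22_jordan (f : polymap K n) : Bir22 f ->
  exists (c : sconst K n) (e : V) (T S N : {mpoly K[n]}),
    [/\ is_jordan c e, alg_rank c e 3, rank3_forms c e T S N,
        lin_equiv f (adjoint_map c e T S)
      & same_ratmap (pmcomp (adjoint_map c e T S) (adjoint_map c e T S)) (@pmid K n)].
Proof.
move=> bir_f; have [A [b [c [t [e [M [p]]]]]]] := Bir22_normalization bir_f.
case=> -[A_unit bP cP tP] hp pN bf [GF FG be teee].
have [i0 [j0 [x0 M0]]] := base_minor_exists bir_f.2.1 A_unit bP cP tP bf GF be teee.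
have FGeq := inverse_eq bP cP tP GF be teee FG M0.
have TF x := (FGeq x).2.
have FF x : 2^-1 *: b (2^-1 *: b x x) (2^-1 *: b x x) = (6^-1 * t x x x) *: x.
  by rewrite -(FGeq _).1 GF.
pose m := jordan_prod b t e.
have mP : symbilinear m := jordan_prod_symbilinear e bP tP.
have me x : m e x = x := jordan_prod_unit be teee x.
have m_cube x : m x (m x x) = _ := jordan_prod_cube bP tP FF be teee TF x.
have m_sq x : m x x = _ := jordan_prod_sq b t e x.
have m_jordan x y : m (m x x) (m x y) = _ := jordan_prod_jordan bP tP FF be teee TF M0 x y.
pose s : sconst K n := fun i j k => m (delta_mx 0 i) (delta_mx 0 j) 0 k.
have sE x y : amul s x y = m x y := amul_symbilinearE mP x y.
have s_jordan : is_jordan s e.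
  split=> [x y|]; first by rewrite !sE (symbilC mP).
  by split=> [x|x y]; rewrite !sE ?me // m_jordan.
pose T := linpoly (fun x => 2^-1 * t e e x).
pose S := quadpoly (fun x y => 2^-1 * t e x y).
have TE x : peval T x = 2^-1 * t e e x.
  by rewrite peval_linpoly // => a y z; rewrite !(symtriE tP); ring.
have SE x : peval S x = 2^-1 * t e x x.
  by rewrite peval_quadpoly // => y a z w; rewrite !(symtriE tP); ring.
have adjE k x : peval (adjoint_map s e T S k) x = (2^-1 *: b x x) 0 k.
  rewrite /peval /adjoint_map mevalD mevalB !mevalM mevalXU mevalC -!/(peval _ x) TE SE.
  have -> : peval (\sum_i \sum_j s i j k *: ('X_i * 'X_j)) x = m x x 0 k.
    rewrite -sE mxE /peval raddf_sum; apply: eq_bigr => i _ /=.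
    rewrite raddf_sum; apply: eq_bigr => j _ /=.
    by rewrite mevalZ mevalM !mevalXU mulrA.
  by rewrite m_sq !mxE; ring.
have Fe : 2^-1 *: b e e = e.
  by rewrite be teee; apply/rowP=> k; rewrite !mxE; field.
have /rV0Pn[i1 ei1] : e != 0.
  by apply: contra_eq_neq teee => ->; rewrite (symtri0l tP) eq_sym Num.Theory.pnatr_eq0.
have adj_neq0 : exists i, adjoint_map s e T S i != 0.
  exists i1; apply: contraNneq ei1 => adj0.
  by have := adjE i1 e; rewrite adj0 peval0 Fe => <-.
have adjadjE k x : peval (pmcomp (adjoint_map s e T S) (adjoint_map s e T S) k) x =
    (6^-1 * t x x x) * x 0 k.
  rewrite peval_pmcomp adjE; have -> : pmeval (adjoint_map s e T S) x = 2^-1 *: b x x.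
    by apply/rowP=> j; rewrite mxE adjE.
  by rewrite FF mxE.
exists s, e, T, S, p; split=> //.
- apply: (@alg_rank3 _ _ s e s_jordan _ x0) => [x|u v w].
    by rewrite !sE m_cube; eexists _, (- _), _; rewrite scaleNr.
  (* Since [x0^2] differs from [F x0] by a combination of [e] and [x0], a relation among [e], [x0],
     [x0^2] is one among [e], [x0], [F x0] with shifted coefficients. *)
  rewrite sE m_sq => uvw; have [|u0 v0 w0] := base_minor_free tP teee M0
    (u := u - w * (2^-1 * t e x0 x0)) (v := v + w * (2^-1 * t e e x0)) (w := w).
    by rewrite -[RHS]uvw; apply/rowP=> k; rewrite !mxE; ring.
  by split=> //; [move: u0|move: v0]; rewrite w0 mul0r ?subr0 ?addr0.
- split; first exact: linpoly_homog.
  split; first exact: quadpoly_homog.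
  split=> // x; rewrite !sE m_cube TE SE pN -/(m x x).
  by move: (m x x) => y; apply/rowP=> k; rewrite !mxE; ring.
(* [A] acts on row vectors from the right whereas [plin] multiplies columns, hence the transpose;
   the source needs no change of coordinates. *)
- exists A^T, 1%:M; split; [by rewrite unitmx_tr|split; first exact: unitmx1].
  have adj_eq k : adjoint_map s e T S k =
      pmcomp (plin A^T) (pmcomp f (plin 1%:M)) k.
    apply: peval_inj => x; rewrite adjE bf peval_pmcomp peval_plin mxE.
    apply: eq_bigr => j _; rewrite !mxE mulrC peval_pmcomp; congr (_ * peval _ _).
    apply/rowP=> l; rewrite mxE peval_plin (bigD1 l) //= mxE eqxx mul1r big1 ?addr0 //.
    by move=> q /negPf ql; rewrite mxE eq_sym ql mul0r.
  split=> //; split; first by case: adj_neq0 => i; rewrite adj_eq; exists i.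
  by move=> i j; rewrite -!adj_eq mulrC.
split; last split.
(* The composite is nonzero because at [e] it takes the value [e], whose coordinate [i1] is
   nonzero. *)
- exists i1; apply: contraNneq ei1 => adj0.
  by have := adjadjE i1 e; rewrite adj0 peval0 teee mulVf ?Num.Theory.pnatr_eq0 // mul1r => <-.
- by exists i1; rewrite /pmid -msupp_eq0 msuppX.
by move=> i j; apply: peval_inj => x; rewrite !pevalM !adjadjE !pevalX; ring.
Qed.

End JordanStructure.

Unset Implicit Arguments.

(* Complex numbers: R[i] with R : realType. *)
Theorem theorem3p4 (R : realType) (n : nat) (f : polymap R[i] n) :
  Bir22 f ->
  exists (c : sconst R[i] n) (e : 'rV[R[i]]_n) (T S N : {mpoly R[i][n]}),
    [/\ is_jordan c e, alg_rank c e 3, rank3_forms c e T S N,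
        lin_equiv f (adjoint_map c e T S)
      & same_ratmap (pmcomp (adjoint_map c e T S) (adjoint_map c e T S))
                    (@pmid R[i] n)].
Proof. exact: Bir22_jordan. Qed.
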